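(* For $r\ge3$, the braid group $B(\infty,\infty,r)$ is isomorphic to the braid group $B(\widetilde{\mathbf{A}}_{r-1})$ of affine type $\widetilde{\mathbf{A}}_{r-1}$.
   Context: $B(\infty,\infty,r)$ is the group with generators $\{t_0,t_1\}\cup\{s_3,\ldots,s_r\}$ and relations: $s_is_j=s_js_i$ for $|i-j|\ge2$; $s_is_{i+1}s_i=s_{i+1}s_is_{i+1}$ for $3\le i\le r-1$; $s_3t_is_3=t_is_3t_i$ for $i=0,1$; $s_jt_i=t_is_j$ for $i=0,1$ and $4\le j\le r$; $s_3(t_1t_0)s_3(t_1t_0)=(t_1t_0)s_3(t_1t_0)s_3$. $B(\widetilde{\mathbf{A}}_{r-1})$ ($r\ge3$) is the group with generators $s_1,\ldots,s_r$ and relations $s_is_j=s_js_i$ for $i-j\not\equiv\pm1\bmod r$ and $s_is_js_i=s_js_is_j$ for $i-j\equiv\pm1\bmod r$. *)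

(* Defs.v *)
From HB Require Import structures.
From mathcomp Require Import all_boot.
From mathcomp Require Import boolp.

Set Implicit Arguments.
Unset Strict Implicit.
Unset Printing Implicit Defensive.

(* Groups given by generators and relations.  [(x, false)] is the letter x,
   [(x, true)] is the letter x^-1. *)
Definition word (X : Type) := seq (X * bool).

Definition positive (X : Type) (u : seq X) : word X :=
  [seq (x, false) | x <- u].

Definition inv_word (X : Type) (w : word X) : word X :=
  rev [seq (a.1, ~~ a.2) | a <- w].

(* All the relations considered here equate positive words, so a set of
   relations is given as [R : seq X -> seq X -> Prop]; [pres_eq R] is the least
   congruence on words that contains R and the free cancellations. *)
Inductive pres_eq (X : Type) (R : seq X -> seq X -> Prop) :
    word X -> word X -> Prop :=
  | pres_refl w : pres_eq R w w
  | pres_sym w1 w2 : pres_eq R w1 w2 -> pres_eq R w2 w1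
  | pres_trans w1 w2 w3 :
      pres_eq R w1 w2 -> pres_eq R w2 w3 -> pres_eq R w1 w3
  | pres_cat w1 w1' w2 w2' :
      pres_eq R w1 w1' -> pres_eq R w2 w2' ->
      pres_eq R (w1 ++ w2) (w1' ++ w2')
  | pres_cancel x b : pres_eq R [:: (x, b); (x, ~~ b)] [::]
  | pres_rel u v : R u v -> pres_eq R (positive u) (positive v).

Section PresentedGroup.
Variables (X : choiceType) (R : seq X -> seq X -> Prop).

Let pres_eqb (w1 w2 : word X) : bool := `[< pres_eq R w1 w2 >].

Let pres_eqb_refl : reflexive pres_eqb.
Proof. by move=> w; apply/asboolP/pres_refl. Qed.

Let pres_eqb_sym : symmetric pres_eqb.
Proof. by move=> w1 w2; apply/asboolP/asboolP; apply: pres_sym. Qed.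

Let pres_eqb_trans : transitive pres_eqb.
Proof.
move=> w2 w1 w3 /asboolP h12 /asboolP h23.
exact/asboolP/(pres_trans h12).
Qed.

Definition pres_equiv : equiv_rel (seq (X * bool)) :=
  EquivRel pres_eqb pres_eqb_refl pres_eqb_sym pres_eqb_trans.

Definition presented : Type := {eq_quot pres_equiv}%qT.
HB.instance Definition _ := Choice.on presented.
HB.instance Definition _ := EqQuotient.on presented.

Definition pres_class (w : word X) : presented := (\pi_presented w)%qT.

Lemma pres_classP (w1 w2 : word X) :
  pres_class w1 = pres_class w2 <-> pres_eq R w1 w2.
Proof.
by split=> [/eqmodP/asboolP | h]; last exact/eqmodP/asboolP.
Qed.

Lemma pres_class_repr (g : presented) : pres_class (repr g) = g.
Proof. exact: reprK. Qed.

Lemma pres_eq_repr (w : word X) : pres_eq R (repr (pres_class w)) w.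
Proof. by apply/pres_classP; rewrite pres_class_repr. Qed.

Lemma inv_word_cat (w1 w2 : word X) :
  inv_word (w1 ++ w2) = inv_word w2 ++ inv_word w1.
Proof. by rewrite /inv_word map_cat rev_cat. Qed.

Lemma inv_wordK : involutive (@inv_word X).
Proof.
move=> w; rewrite /inv_word map_rev revK -map_comp map_id_in //.
by case=> x b _ /=; rewrite negbK.
Qed.

Lemma pres_catV (w : word X) : pres_eq R (w ++ inv_word w) [::].
Proof.
elim: w => [|[x b] w IH]; first exact: pres_refl.
rewrite -[(x, b) :: w]cat1s inv_word_cat -catA.
apply: (pres_trans (w2 := [:: (x, b)] ++ [:: (x, ~~ b)])).
  apply: pres_cat; first exact: pres_refl.
  rewrite catA -[X in pres_eq _ _ X]cat0s.
  by apply: pres_cat; [exact: IH | exact: pres_refl].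
exact: pres_cancel.
Qed.

Lemma pres_Vcat (w : word X) : pres_eq R (inv_word w ++ w) [::].
Proof. by rewrite -{2}[w]inv_wordK; apply: pres_catV. Qed.

Lemma pres_inv (w1 w2 : word X) :
  pres_eq R w1 w2 -> pres_eq R (inv_word w1) (inv_word w2).
Proof.
move=> h; have h' := pres_refl R (inv_word w1).
apply: (pres_trans (w2 := inv_word w1 ++ (w2 ++ inv_word w2))).
  rewrite -{1}[inv_word w1]cats0.
  by apply: pres_cat => //; apply/pres_sym/pres_catV.
rewrite catA -[X in pres_eq _ _ X]cat0s.
apply: pres_cat; last exact: pres_refl.
apply: (pres_trans (w2 := inv_word w1 ++ w1)); last exact: pres_Vcat.
by apply: pres_cat => //; apply: pres_sym.
Qed.

Definition pres_one : presented := pres_class [::].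
Definition pres_mul (g h : presented) : presented :=
  pres_class (repr g ++ repr h).
Definition pres_invg (g : presented) : presented :=
  pres_class (inv_word (repr g)).

Lemma pres_mulE (w1 w2 : word X) :
  pres_mul (pres_class w1) (pres_class w2) = pres_class (w1 ++ w2).
Proof. by apply/pres_classP/pres_cat; apply: pres_eq_repr. Qed.

Lemma pres_invgE (w : word X) :
  pres_invg (pres_class w) = pres_class (inv_word w).
Proof. by apply/pres_classP/pres_inv/pres_eq_repr. Qed.

Lemma pres_mulgA : associative pres_mul.
Proof.
move=> g h k; rewrite -(pres_class_repr g) -(pres_class_repr h).
by rewrite -(pres_class_repr k) !pres_mulE catA.
Qed.

Lemma pres_mul1g : left_id pres_one pres_mul.
Proof. by move=> g; rewrite -(pres_class_repr g) pres_mulE. Qed.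

Lemma pres_mulg1 : right_id pres_one pres_mul.
Proof. by move=> g; rewrite -(pres_class_repr g) pres_mulE cats0. Qed.

Lemma pres_mulVg : left_inverse pres_one pres_invg pres_mul.
Proof.
move=> g; rewrite -(pres_class_repr g) pres_invgE pres_mulE.
exact/pres_classP/pres_Vcat.
Qed.

Lemma pres_mulgV : right_inverse pres_one pres_invg pres_mul.
Proof.
move=> g; rewrite -(pres_class_repr g) pres_invgE pres_mulE.
exact/pres_classP/pres_catV.
Qed.

HB.instance Definition _ := isGroup.Build presented
  pres_mulgA pres_mul1g pres_mulg1 pres_mulVg pres_mulgV.

End PresentedGroup.

(* Generators of B(oo,oo,r): [inl i] is t_i, so that t_0 is
   [inl ord0] and t_1 is [inl ord_max], and [inr i] is s_i
   (3 <= i <= r). *)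
Definition binf_gen (r : nat) : choiceType :=
  ('I_2 + {i : nat | 3 <= i <= r})%type.

Definition tgen (r : nat) (i : 'I_2) : binf_gen r := inl i.
Definition sgen (r : nat) (i : {i : nat | 3 <= i <= r}) : binf_gen r := inr i.

Inductive binf_rel (r : nat) : seq (binf_gen r) -> seq (binf_gen r) -> Prop :=
  | binf_ss_comm (i j : {i : nat | 3 <= i <= r}) :
      (val i + 2 <= val j) || (val j + 2 <= val i) ->
      binf_rel [:: sgen i; sgen j] [:: sgen j; sgen i]
  | binf_ss_braid (i j : {i : nat | 3 <= i <= r}) : val j = val i + 1 ->
      binf_rel [:: sgen i; sgen j; sgen i] [:: sgen j; sgen i; sgen j]
  | binf_st_braid (k : {i : nat | 3 <= i <= r}) (i : 'I_2) : val k = 3 ->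
      binf_rel [:: sgen k; tgen r i; sgen k]
               [:: tgen r i; sgen k; tgen r i]
  | binf_st_comm (j : {i : nat | 3 <= i <= r}) (i : 'I_2) : 4 <= val j ->
      binf_rel [:: sgen j; tgen r i] [:: tgen r i; sgen j]
  | binf_stt (k : {i : nat | 3 <= i <= r}) : val k = 3 ->
      binf_rel [:: sgen k; tgen r ord_max; tgen r ord0;
                   sgen k; tgen r ord_max; tgen r ord0]
               [:: tgen r ord_max; tgen r ord0; sgen k;
                   tgen r ord_max; tgen r ord0; sgen k].

Definition Binf (r : nat) : groupType := presented (@binf_rel r).

Definition affA_gen (r : nat) : choiceType := {i : nat | 1 <= i <= r}.

Definition cyc_adjacent (r i j : nat) : bool :=
  (i == j + 1 %[mod r]) || (j == i + 1 %[mod r]).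

Inductive affA_rel (r : nat) : seq (affA_gen r) -> seq (affA_gen r) -> Prop :=
  | affA_comm (i j : affA_gen r) : ~~ cyc_adjacent r (val i) (val j) ->
      affA_rel [:: i; j] [:: j; i]
  | affA_braid (i j : affA_gen r) : cyc_adjacent r (val i) (val j) ->
      affA_rel [:: i; j; i] [:: j; i; j].

(* [BaffA r] is the braid group of affine type A_{r-1}, on r generators. *)
Definition BaffA (r : nat) : groupType := presented (@affA_rel r).

(* Main.v *)
(* Put c = s_3 s_4 ... s_r.  The isomorphism sends s_j to s_j for j >= 3, t_1 to
   s_2 and t_0 to c s_1 c^-1.  Conjugation by c shifts the braid generators,
   c s_i c^-1 = s_(i+1) for 3 <= i < r, so that "s_1 commutes with s_i for
   3 <= i < r" translates to "t_0 commutes with s_j for j >= 4"; moreover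
   c^-1 s_3 c = d s_r d^-1 with d = s_3 ... s_(r-1), which turns the braid relation
   of s_1 and s_r into that of t_0 and s_3.  Finally, if s braids with t
   and y, the relation s(ty)s(ty) = (ty)s(ty)s says exactly that t braids with
   s^-1 y s. *)
From HB Require Import structures.
Require Import Defs.
From mathcomp Require Import all_boot.
From mathcomp Require Import zify.

Set Implicit Arguments.
Unset Strict Implicit.
Unset Printing Implicit Defensive.

Local Open Scope group_scope.

(** * Braid relations and conjugation in a group *)

Section BraidRelation.
Variable G : groupType.
Implicit Types x y z s t : G.

Definition braided x y := x * y * x = y * x * y.

Lemma commute_conj x y z : commute (x ^ z) (y ^ z) <-> commute x y.
Proof. by rewrite /commute -!conjMg; split=> [/conjg_inj|->]. Qed.

Lemma braided_conj x y z : braided (x ^ z) (y ^ z) <-> braided x y.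
Proof. by rewrite /braided -!conjMg; split=> [/conjg_inj|->]. Qed.

Lemma conjg_commute x y : commute x y -> x ^ y = x.
Proof. by move=> xy; rewrite /conjg xy mulKg. Qed.

(** Moving [s] leftwards by [y * s = s * z], where [z = y ^ s], isolates [t * z * t] on one side and
    [z * t * z] on the other, between equal outer factors that cancel. *)
Lemma six_term_braided s t y : braided t s -> braided y s ->
  s * t * y * s * t * y = t * y * s * t * y * s <-> braided t (y ^ s).
Proof.
move=> ts ys; set z := y ^ s.
have zs : z * s * z = s * z * s.
  have: braided (y ^ s) (s ^ s) by apply/braided_conj.
  by rewrite [s ^ s]conjg_commute.
have sz : s * z = y * s by rewrite /z -conjgC.
clearbody z.
(* The extra factor [s] on the right allows the last [y] on the left-hand side to be absorbed into
   [s * z] as well. *)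
have -> : (s * t * y * s * t * y = t * y * s * t * y * s) <->
          (s * t * y * s * t * y * s = t * y * s * t * y * s * s).
  by split=> [->|/mulIg].
have -> : s * t * y * s * t * y * s = t * s * (t * z * t) * (s * z).
  by rewrite -(mulgA (s * t) y) -(mulgA _ y s) -sz !mulgA ts.
have -> : t * y * s * t * y * s * s = t * s * (z * t * z) * (s * z).
  rewrite -(mulgA t y) -(mulgA _ y s) -sz !mulgA.
  by rewrite -(mulgA _ s z) -(mulgA _ (s * z) s) -zs !mulgA.
by split=> [/mulIg /mulgI|->].
Qed.

End BraidRelation.

(** * Braid generators of finite type A and their partial products *)

Section BraidChain.
Variables (G : groupType) (a : nat -> G) (m n : nat).

Definition braid_chain :=
  (forall i j, m <= i -> i.+1 < j -> j < n -> commute (a i) (a j)) /\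
  (forall i, m <= i -> i.+1 < n -> braided (a i) (a i.+1)).

Local Notation c k := (\prod_(m <= i < k) a i).

Lemma commute_prod_nat x p k :
  (forall i, p <= i -> i < k -> commute x (a i)) ->
  commute x (\prod_(p <= i < k) a i).
Proof.
move=> xa; rewrite big_nat_cond.
by apply: commute_prod => i; rewrite andbT => /andP[]; apply: xa.
Qed.

Hypothesis chain_a : braid_chain.

(** Conjugating factor by factor: those before [a i] fix [a i.+1], the pair [a i * a i.+1] turns it
    into [a i] by the braid relation, and the later factors fix [a i]. *)
Lemma conjg_chain_prod i k :
  m <= i -> i.+1 < k -> k <= n -> a i.+1 ^ c k = a i.
Proof.
case: chain_a => aC aB mi; elim: k => // k IH ik kn.
have mk : m <= k by lia.
rewrite big_nat_recr //= conjgM.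
have [ik'|ki] := ltnP i.+1 k.
  by rewrite IH ?conjg_commute //; [apply: aC; lia | lia].
have ek : k = i.+1 by lia.
subst k.
rewrite big_nat_recr //= conjgM [a i.+1 ^ _]conjg_commute.
  rewrite -conjgM /conjg [a i.+1 * _]mulgA -aB ?mulKg //; lia.
apply: commute_prod_nat => j mj ji; apply/commute_sym/aC; lia.
Qed.

(** Induction on [k] from [k = m]: the braid relation gives [a k.+1 ^ (a k)^-1 = a k ^ a k.+1], and
    [a k.+1] commutes with [c k], so the two conjugations can be exchanged. *)
Lemma conjg_last_chain_prod k :
  m <= k -> k < n -> a k ^ (c k)^-1 = a m ^ c k.+1.
Proof.
case: chain_a => aC aB; elim: k => [|k IH] mk kn.
  have -> : m = 0 by lia.
  by rewrite big_geq // big_nat1 invg1 conjg1 conjg_commute.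
have [mk'|km] := leqP m k; last first.
  have -> : m = k.+1 by lia.
  by rewrite big_geq // big_nat1 invg1 conjg1 conjg_commute.
have kn' : k < n by lia.
rewrite [c k.+2]big_nat_recr //= conjgM -IH //.
have ck : commute (a k.+1) (c k).
  by apply: commute_prod_nat => j mj jk; apply/commute_sym/aC; lia.
rewrite big_nat_recr //= invgM conjgM.
have -> : a k.+1 ^ (a k)^-1 = a k ^ a k.+1.
  rewrite /conjg invgK; apply: (mulgI (a k.+1)); rewrite mulVKg !mulgA.
  by rewrite -aB // mulgK.
by rewrite conjJg [a k.+1 ^ _]conjg_commute //; apply: commuteV.
Qed.

End BraidChain.

(** * Matching the two sets of relations inside an arbitrary group *)

Section Transfer.
Variables (G : groupType) (r : nat).
Hypothesis r_ge3 : 3 <= r.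

(** Pairs with [i < j] suffice: both kinds of relation are symmetric, and trivial on the
    diagonal. *)
Definition affA_relations (b : nat -> G) :=
  forall i j, 0 < i -> i < j -> j <= r ->
    if cyc_adjacent r i j then braided (b i) (b j) else commute (b i) (b j).

Definition binf_relations (t0 t1 : G) (a : nat -> G) :=
  [/\ braid_chain a 3 r.+1,
      (forall j, 3 < j -> j <= r -> commute t0 (a j) /\ commute t1 (a j)),
      braided t0 (a 3), braided t1 (a 3) &
      a 3 * t1 * t0 * a 3 * t1 * t0 = t1 * t0 * a 3 * t1 * t0 * a 3].

Lemma cyc_adjacentE i j : 0 < i -> i < j -> j <= r ->
  cyc_adjacent r i j = (j == i.+1) || (i == 1%N) && (j == r).
Proof.
move=> i0 ij jr; rewrite /cyc_adjacent !addn1.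
have ir : i < r by lia.
rewrite (modn_small ir).
(* The index [r] has residue 0, so the residues depend on which of [j], [j.+1] and [i.+1] reach
   [r]. *)
have [jr'|jr'] := ltnP j r.
  rewrite (modn_small jr').
  have [ir1|ir1] := ltnP j.+1 r; have [ir2|ir2] := ltnP i.+1 r;
    try lia.
  - by rewrite !modn_small //; lia.
  - have -> : j.+1 = r by lia.
    by rewrite modnn modn_small //; lia.
have -> : j = r by lia.
rewrite modnn -add1n modnDr modn_small; last lia.
have [ir2|ir2] := ltnP i.+1 r; first by rewrite modn_small //; lia.
have -> : i.+1 = r by lia.
by rewrite modnn; lia.
Qed.

Local Notation c a := (\prod_(3 <= i < r.+1) a i).

(** The cyclic diagram is cut into the chain on 3, ..., r, the vertex 2 attached to 3, and the
    vertex 1 attached to 2 and r, to be compared with [binf_relations] piece by piece. *)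
Lemma affA_relationsP b : affA_relations b <->
  [/\ braid_chain b 3 r.+1,
      (forall j, 3 < j -> j <= r -> commute (b 2) (b j)),
      braided (b 2) (b 3),
      (forall i, 2 < i -> i < r -> commute (b 1%N) (b i)) &
      braided (b 1%N) (b 2) /\ braided (b 1%N) (b r)].
Proof.
split=> [rel|[[bC bB] b2C b23 b1C [b12 b1r]] i j i0 ij jr].
  have adj i j : 0 < i -> i < j -> j <= r ->
      (j == i.+1) || (i == 1%N) && (j == r) -> braided (b i) (b j).
    by move=> i0 ij jr h; have := rel i j i0 ij jr; rewrite cyc_adjacentE ?h.
  have nadj i j : 0 < i -> i < j -> j <= r ->
      ~~ ((j == i.+1) || (i == 1%N) && (j == r)) -> commute (b i) (b j).
    move=> i0 ij jr /negPf h; have := rel i j i0 ij jr.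
    by rewrite cyc_adjacentE ?h.
  by split; [split|..|split]; move=> *; (apply: adj || apply: nadj); lia.
rewrite cyc_adjacentE //.
case: i i0 ij => [|[|[|i]]] // _ ij.
- have [->|j2] := eqVneq j 2; first exact: b12.
  have [-> //|jr'] := eqVneq j r.
  by apply: b1C; lia.
- have [-> /=|j3] := eqVneq j 3; first exact: b23.
  by apply: b2C; lia.
- have [-> /=|j4] := eqVneq j i.+4; first by apply: bB; lia.
  by apply: bC; lia.
Qed.

Lemma affA_binf_relations b :
  affA_relations b <-> binf_relations (b 1%N ^ (c b)^-1) (b 2) b.
Proof.
rewrite affA_relationsP; set y := b 1%N ^ _.
have b1 : b 1%N = y ^ c b by rewrite conjgKV.
(* Conjugation by [c b] takes [y] to [b 1] and [b j] to its predecessor in the chain. *)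
have comm_shift : braid_chain b 3 r.+1 ->
    (forall i, 2 < i -> i < r -> commute (b 1%N) (b i)) <->
    (forall j, 3 < j -> j <= r -> commute y (b j)).
  move=> chb; split=> h [|j] // j1 j2.
    apply/(commute_conj _ _ (c b)); rewrite -b1 (conjg_chain_prod chb) //.
    by apply: h; lia.
  rewrite b1 -(conjg_chain_prod chb (k := r.+1)) //.
  by apply/commute_conj/h; lia.
(* Conjugation by [c b] takes [b 3] to [b r ^ d^-1] with [d] the product of [b 3], ..., [b (r - 1)];
   since [b 1] commutes with [d], the conjugation by [d^-1] can be removed. *)
have braid_shift : braid_chain b 3 r.+1 ->
    (forall i, 2 < i -> i < r -> commute (b 1%N) (b i)) ->
    braided (b 1%N) (b r) <-> braided y (b 3).
  move=> chb b1C; rewrite -(braided_conj y _ (c b)) -b1.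
  rewrite -(conjg_last_chain_prod chb) //.
  rewrite -[X in _ <-> braided X _](@conjg_commute _ (b 1%N)
            (\prod_(3 <= i < r) b i)^-1) ?braided_conj //.
  by apply/commuteV/commute_prod_nat.
(* Writing [c b = b 3 * c'] gives [b 1 = (y ^ b 3) ^ c'], and [c'] commutes with [b 2]; hence the
   braiding of [b 1] and [b 2] is that of [y ^ b 3] and [b 2]. *)
have six_shift : (forall j, 3 < j -> j <= r -> commute (b 2) (b j)) ->
    braided (b 2) (b 3) -> braided y (b 3) ->
    braided (b 1%N) (b 2) <->
    b 3 * b 2 * y * b 3 * b 2 * y = b 2 * y * b 3 * b 2 * y * b 3.
  move=> b2C b23 y3; rewrite six_term_braided // b1 big_ltn // conjgM.
  set c' := \prod_(4 <= i < r.+1) b i.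
  rewrite -[X in braided _ X <-> _](@conjg_commute _ (b 2) c') //.
    by rewrite braided_conj; split.
  by apply: commute_prod_nat => i i4 ir; apply: b2C.
split.
  case=> chb b2C b23 b1C [b12 b1r].
  have yC := (comm_shift chb).1 b1C.
  have y3 := (braid_shift chb b1C).1 b1r.
  by split=> // [j j3 jr|]; [split; [apply: yC | apply: b2C]|apply/six_shift].
case=> chb yb2C y3 b23 six.
have b2C j : 3 < j -> j <= r -> commute (b 2) (b j).
  by move=> j3 jr; have [] := yb2C j j3 jr.
have b1C : forall i, 2 < i -> i < r -> commute (b 1%N) (b i).
  by apply/comm_shift => // j j3 jr; have [] := yb2C j j3 jr.
by split=> //; split; [apply/six_shift | apply/braid_shift].
Qed.

End Transfer.

(** * Universal property of a presented group *)

Section Presentation.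
Variables (X : choiceType) (R : seq X -> seq X -> Prop).

Definition pres_gen (x : X) : presented R := pres_class R [:: (x, false)].

Definition satisfies (G : groupType) (phi : X -> G) :=
  forall u v, R u v -> \prod_(x <- u) phi x = \prod_(x <- v) phi x.

Lemma pres_classM (v w : word X) :
  pres_class R (v ++ w) = pres_class R v * pres_class R w.
Proof. by rewrite -pres_mulE. Qed.

Lemma satisfies_pres_gen : satisfies pres_gen.
Proof.
have genE u : \prod_(x <- u) pres_gen x = pres_class R (positive u).
  elim: u => [|x u IH]; first by rewrite big_nil.
  by rewrite big_cons IH -pres_classM.
by move=> u v Ruv; rewrite !genE; apply/pres_classP/pres_rel.
Qed.

(** Existence half of the universal property: letterwise evaluation of words is constant on classes,
    so evaluating a chosen representative is multiplicative. *)
Lemma pres_lift (G : groupType) (phi : X -> G) : satisfies phi ->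
  exists f : UMagmaMorphism.type (presented R) G,
    forall x, f (pres_gen x) = phi x.
Proof.
move=> phiR.
pose ev (w : word X) := \prod_(a <- w) (if a.2 then (phi a.1)^-1 else phi a.1).
have ev_cat v w : ev (v ++ w) = ev v * ev w by rewrite /ev big_cat.
have ev_pos u : ev (positive u) = \prod_(x <- u) phi x by rewrite /ev big_map.
have ev_eq v w : pres_eq R v w -> ev v = ev w.
  elim=> {v w} [//|v w _ ->|u v w _ -> _ ->|v v' w w' _ ev_v _ ev_w|x b|u v Ruv].
  - by [].
  - by [].
  - by rewrite !ev_cat ev_v ev_w.
  - by rewrite /ev !big_cons big_nil; case: b; rewrite /= mulg1 ?mulgV ?mulVg.
  - by rewrite !ev_pos; apply: phiR.
pose f (g : presented R) := ev (repr g).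
have fE w : f (pres_class R w) = ev w by apply/ev_eq/pres_eq_repr.
have fM : monoid_morphism f.
  split=> [|g h]; first by rewrite [f _]fE /ev big_nil.
  by rewrite [f (g * h)]fE ev_cat.
pose F := HB.pack_for (UMagmaMorphism.type (presented R) G) f
  (isUMagmaMorphism.Build _ _ f fM).
by exists F => x; rewrite [LHS]fE /ev big_cons big_nil mulg1.
Qed.

(** Uniqueness half of the universal property, in the form needed to recognise mutually inverse
    homomorphisms. *)
Lemma pres_hom_id (f : UMagmaMorphism.type (presented R) (presented R)) :
  (forall x, f (pres_gen x) = pres_gen x) -> f =1 id.
Proof.
move=> fgen g; rewrite -(pres_class_repr g).
elim: (repr g) => [|[x b] w IH]; first exact: gmulf1.
rewrite -cat1s pres_classM gmulfM IH; congr (_ * _).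
case: b; last exact: fgen.
have -> : pres_class R [:: (x, true)] = (pres_gen x)^-1.
  exact/esym/(pres_invgE R [:: (x, false)]).
by rewrite gmulfV fgen.
Qed.

End Presentation.

Section NatGenerators.
Variables (P : pred nat) (G : groupType) (phi : {i | P i} -> G).

(* Indexing by [nat], with junk value 1 off [P], avoids carrying membership proofs
   through index shifts. *)
Definition nat_family (i : nat) : G := oapp phi 1 (insub i).

Lemma nat_familyE i : nat_family (val i) = phi i.
Proof. by rewrite /nat_family valK. Qed.

Lemma nat_family_exist i (Pi : P i) : nat_family i = phi (exist _ i Pi).
Proof. exact: (nat_familyE (exist _ i Pi)). Qed.

End NatGenerators.

(** * The relations of the two presentations, written as conditions on families indexed by [nat] *)

Section SatisfyRelations.
Variables (G : groupType) (r : nat).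

Lemma satisfies_affA (b : nat -> G) :
  satisfies (@affA_rel r) (fun i => b (val i)) <-> affA_relations r b.
Proof.
split=> [sat i j i0 ij jr|rel].
  have Pi : 0 < i <= r by lia.
  have Pj : 0 < j <= r by lia.
  case: ifP => h.
    have := sat _ _ (affA_braid (i := Sub i Pi) (j := Sub j Pj) h).
    by rewrite !big_cons !big_nil !mulg1 !mulgA.
  have := sat _ _ (affA_comm (i := Sub i Pi) (j := Sub j Pj) (negbT h)).
  by rewrite !big_cons !big_nil !mulg1.
move=> u v [] [i Pi] [j Pj] /= adj; rewrite !big_cons !big_nil !mulg1 ?mulgA /=.
  (* Pairs with [j < i] are reduced to [i < j] by the symmetry of adjacency and of the relation. *)
  case: (ltngtP i j) => [ij|ji|-> //].
    have := rel i j; rewrite (negPf adj); apply; lia.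
  have := rel j i; rewrite /cyc_adjacent orbC in adj *.
  rewrite (negPf adj) => h; symmetry; apply: h; lia.
case: (ltngtP i j) => [ij|ji|-> //].
  have := rel i j; rewrite adj; apply; lia.
have := rel j i; rewrite /cyc_adjacent orbC in adj *.
rewrite adj => h; symmetry; apply: h; lia.
Qed.

Hypothesis r_ge3 : 3 <= r.

Definition binf_point (t0 t1 : G) (a : nat -> G) (x : binf_gen r) : G :=
  match x with
  | inl i => if i == ord0 then t0 else t1
  | inr j => a (val j)
  end.

Lemma satisfies_binf t0 t1 a :
  satisfies (@binf_rel r) (binf_point t0 t1 a) <-> binf_relations r t0 t1 a.
Proof.
split=> [sat|[[aC aB] tC t03 t13 six]].
  have P3 : 3 <= 3 <= r by lia.
  pose k : {i | 3 <= i <= r} := Sub 3 P3.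
  have bg := (big_cons, big_nil, @mulg1 G, @mulgA G).
  split=> [|j j3 jr|||].
  - split=> [i j i3 ij jr|i i3 ir].
      have Pi : 3 <= i <= r by lia.
      have Pj : 3 <= j <= r by lia.
      have h : (i + 2 <= j) || (j + 2 <= i) by lia.
      have := sat _ _ (binf_ss_comm (i := Sub i Pi) (j := Sub j Pj) h).
      by rewrite !bg /=.
    have Pi : 3 <= i <= r by lia.
    have Pj : 3 <= i.+1 <= r by lia.
    have h : i.+1 = i + 1 by lia.
    have := sat _ _ (binf_ss_braid (i := Sub i Pi) (j := Sub i.+1 Pj) h).
    by rewrite !bg /=.
  - have Pj : 3 <= j <= r by lia.
    have tj i := sat _ _ (binf_st_comm (j := Sub j Pj) i j3).
    have := tj ord0; have := tj ord_max.
    by rewrite !bg /= => h1 h0; split; symmetry.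
  - by have := sat _ _ (binf_st_braid (k := k) ord0 erefl); rewrite !bg.
  - by have := sat _ _ (binf_st_braid (k := k) ord_max erefl); rewrite !bg.
  - by have := sat _ _ (binf_stt (k := k) erefl); rewrite !bg.
move=> u v [] => [[i Pi] [j Pj]|[i Pi] [j Pj]|[k Pk] i|[j Pj] i|[k Pk]] /=;
  rewrite !big_cons !big_nil !mulg1 ?mulgA /=.
- by case/orP => h; [|symmetry]; apply: aC; lia.
- by move=> ej; rewrite ej addn1; apply: aB; lia.
- by move=> ->; case: ifP.
- move=> j4; have [] := tC j; [lia..|].
  by move=> h0 h1; symmetry; case: ifP.
- by move=> ->.
Qed.

End SatisfyRelations.

Theorem corollary4p4 (r : nat) (hr : 3 <= r) :
  exists f : {multiplicative Binf r -> BaffA r}, bijective f.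
Proof.
pose t i : Binf r := pres_gen (@binf_rel r) (tgen r i).
pose s : nat -> Binf r :=
  nat_family (fun j => pres_gen (@binf_rel r) (sgen j)).
pose b : nat -> BaffA r := nat_family (pres_gen (@affA_rel r)).
pose c (G : groupType) (a : nat -> G) := \prod_(3 <= i < r.+1) a i.
have s_rel : binf_relations r (t ord0) (t ord_max) s.
  apply/(satisfies_binf hr) => u v Ruv.
  have genE : binf_point (t ord0) (t ord_max) s =1 pres_gen (@binf_rel r).
    move=> [i|j] /=; last exact: nat_familyE.
    case: eqVneq => [-> //|i0]; congr (pres_gen _ (inl _)).
    by apply: val_inj; case: i i0 => [[|[|]]].
  by rewrite !(eq_bigr _ (fun x _ => genE x)); apply: satisfies_pres_gen.
have b_rel : affA_relations r b.
  apply/satisfies_affA => u v Ruv.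
  by rewrite !(eq_bigr _ (fun x _ => nat_familyE _ x)); apply: satisfies_pres_gen.
(* The equivalence of relations, read forwards on the generators [b], yields [f]; read backwards on
   [s'], it yields the inverse [g]. *)
have b_sat := (satisfies_binf hr _ _ _).2 ((affA_binf_relations hr b).1 b_rel).
have [f fE] := pres_lift b_sat.
(* Images under [g] of the affine generators: [s_1] goes to [c^-1 t_0 c], [s_2] to [t_1], and the
   others to themselves; the value at index 0 is junk. *)
pose s' i := if i is i'.+1 then
    if i' is i''.+1 then if i'' is 0 then t ord_max else s i
    else t ord0 ^ c _ s
  else 1.
(* The product starts at index 3, where [s'] agrees with [s]; conjugating [s' 1] back by its inverse
   therefore returns [t_0]. *)
have cs' : c _ s' = c _ s by apply: eq_big_nat => -[|[|[|]]].
have s'_rel : affA_relations r s'.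
  apply/(affA_binf_relations hr); rewrite -/(c _ s') cs' /= conjgK.
  case: s_rel => [[sC sB] tC t03 t13 six].
  split=> //; last by move=> [|[|[|[|j]]]] // *; apply: tC.
  by split=> [[|[|[|i]]] // [|[|[|j]]] // *|[|[|[|i]]] // *];
    [apply: sC | apply: sB].
have [g gE] := pres_lift ((satisfies_affA _ _).2 s'_rel).
have fs j : 2 < j -> j < r.+1 -> f (s j) = b j.
  move=> j2 jr; have Pj : 3 <= j <= r by lia.
  by rewrite /s (nat_family_exist _ Pj) fE.
have gb j : 0 < j -> j < r.+1 -> g (b j) = s' j.
  move=> j0 jr; have Pj : 0 < j <= r by lia.
  by rewrite /b (nat_family_exist _ Pj) gE.
(* Since [f] and [g] match the generators of index at least 3, they exchange the two products, so
   the conjugations in the images of [t_0] and [s_1] cancel. *)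
have fc : f (c _ s) = c _ b.
  by rewrite gmulf_prod; apply: eq_big_nat => j /andP[]; apply: fs.
have gc : g (c _ b) = c _ s.
  rewrite gmulf_prod -cs'; apply: eq_big_nat => j /andP[j2 jr].
  by apply: gb; lia.
exists f; exists g.
  apply: (pres_hom_id (f := g \o f)) => -[i|[j Pj]]; rewrite /= fE /=.
    case: eqVneq => [->|i0].
      rewrite gmulfJ gmulfV gc gb //; last lia.
      exact: conjgK.
    rewrite gb //; last lia.
    by congr (pres_gen _ (inl _)); apply: val_inj; case: i i0 => [[|[|]]].
  rewrite gb; [|lia..].
  case: j Pj => [|[|[|j]]] // Pj.
  exact: nat_family_exist.
apply: (pres_hom_id (f := f \o g)) => -[i Pi]; rewrite /= gE /=.
rewrite -[RHS](nat_family_exist (pres_gen _)) -/b.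
case: i Pi => [|[|[|i]]] // Pi.
- by rewrite /= gmulfJ fc fE /= conjgKV.
- by rewrite /= fE.
- by rewrite /= fs //; lia.
Qed.
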